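(* Let $A$ be the class of $(\text{diamond},\text{co-diamond})$-free graphs. For all integers $a,b\ge 3$, $$R_A(a,b)=\max\{2a-1,\,2b-1\},$$ unless $a,b\in\{4,5\}$, in which case $R_A(a,b)=10$, and unless $a=b=3$, in which case $R_A(a,b)=6$.
   Context: All graphs are finite, undirected, without loops or multiple edges. The diamond is the complete graph $K_4$ with one edge removed; the co-diamond is its complement, i.e. the disjoint union of one edge and two isolated vertices. A graph is $(H_1,\dots,H_k)$-free if it contains none of $H_1,\dots,H_k$ as an induced subgraph. For a class $A$ of graphs, $R_A(a,b)$ is the minimum $n$ such that every graph in $A$ with at least $n$ vertices has either a clique of size $a$ or an independent set of size $b$. *)

(* Defs.v *)
From HB Require Import structures.
From mathcomp Require Import all_boot.

Set Implicit Arguments.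
Unset Strict Implicit.
Unset Printing Implicit Defensive.

Record sgraph := SGraph {
  vertex :> finType;
  adj : rel vertex;
  adj_sym : symmetric adj;
  adj_irrefl : irreflexive adj }.

Definition compl_adj (G : sgraph) : rel G :=
  fun x y => (x != y) && ~~ adj x y.

Lemma compl_adj_sym (G : sgraph) : symmetric (@compl_adj G).
Proof. by move=> x y; rewrite /compl_adj eq_sym adj_sym. Qed.

Lemma compl_adj_irrefl (G : sgraph) : irreflexive (@compl_adj G).
Proof. by move=> x; rewrite /compl_adj eqxx. Qed.

Definition complement (G : sgraph) : sgraph :=
  SGraph (@compl_adj_sym G) (@compl_adj_irrefl G).

(* K_4 on the vertices 0, 1, 2, 3 with the edge {0, 1} removed. *)
Definition diamond_adj : rel 'I_4 :=
  fun x y => (x != y) && ~~ ((x < 2) && (y < 2)).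

Lemma diamond_adj_sym : symmetric diamond_adj.
Proof. by move=> x y; rewrite /diamond_adj eq_sym (andbC (x < 2)). Qed.

Lemma diamond_adj_irrefl : irreflexive diamond_adj.
Proof. by move=> x; rewrite /diamond_adj eqxx. Qed.

Definition diamond : sgraph := SGraph diamond_adj_sym diamond_adj_irrefl.

Definition co_diamond : sgraph := complement diamond.

Definition induced_subgraph (H G : sgraph) : Prop :=
  exists2 f : H -> G, injective f & forall x y : H, adj (f x) (f y) = adj x y.

Definition diamond_co_diamond_free (G : sgraph) : Prop :=
  ~ induced_subgraph diamond G /\ ~ induced_subgraph co_diamond G.

Definition is_clique (G : sgraph) (S : {set G}) : Prop :=
  {in S &, forall x y, x != y -> adj x y}.

Definition is_independent (G : sgraph) (S : {set G}) : Prop :=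
  {in S &, forall x y, ~~ adj x y}.

Definition ramsey_bound (A : sgraph -> Prop) (a b n : nat) : Prop :=
  forall G : sgraph, A G -> n <= #|G| ->
    (exists2 S : {set G}, is_clique S & #|S| = a) \/
    (exists2 S : {set G}, is_independent S & #|S| = b).

(* R_A(a, b) = n. Stated as a relation, so that asserting a value of R_A(a, b)
   includes the assertion that the minimum exists. *)
Definition is_ramsey_number (A : sgraph -> Prop) (a b n : nat) : Prop :=
  ramsey_bound A a b n /\ forall m, ramsey_bound A a b m -> n <= m.

(* Main.v *)
Require Import Defs.
From mathcomp Require Import all_boot.
From mathcomp Require Import zify.

Set Implicit Arguments.
Unset Strict Implicit.
Unset Printing Implicit Defensive.

(** If a clique of size at least 4 exists, take a maximum one [T].  A vertex
    outside [T] has at most one neighbour in [T] (no diamond), so two vertices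
    outside [T] have two common non-neighbours in [T] and are adjacent (no
    co-diamond): [G] is covered by two cliques, hence [#|G| <= 2 * #|T|].  The
    dual statement holds for independent sets, so it remains to bound [#|G|] when
    there is no homogeneous set of size 4.  Then the neighbourhood of a vertex is
    a disjoint union of cliques of size at most 2; with 5 vertices it would
    contain four independent ones or a co-diamond.  So all degrees in [G] and its
    complement are at most 4 and [#|G| <= 9].  If
    moreover there is no triangle, an independent set [I] of size 3 exists when
    [#|G| >= 6]; every other vertex has at least two neighbours in [I], so two
    other vertices share one and are not adjacent: [#|G| <= 6].
    Extremal graphs are the 5-cycle, the 3 x 3 rook's
    graph, the disjoint union of two equal cliques, and its complement. *)

(** * Induced subgraphs and homogeneous sets under complementation *)

Definition has_clique (G : sgraph) (k : nat) : Prop :=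
  exists2 S : {set G}, is_clique S & #|S| = k.

Definition has_independent (G : sgraph) (k : nat) : Prop :=
  exists2 S : {set G}, is_independent S & #|S| = k.

Lemma neq_adj (G : sgraph) (x y : G) : adj x y -> x != y.
Proof. by apply: contraTneq => ->; rewrite adj_irrefl. Qed.

(** Stated edge by edge because [complement (complement G)] is not convertible to [G]. *)
Lemma adj_complement2 (G : sgraph) (x y : G) :
  compl_adj (G := complement G) x y = adj x y.
Proof.
rewrite /compl_adj /= /compl_adj.
by case: eqVneq => [->|]; rewrite ?adj_irrefl //= negbK.
Qed.

Lemma diamond_freeP (G : sgraph) :
  ~ induced_subgraph diamond G <->
  (forall u w x y : G, adj u w -> adj u x -> adj w x -> adj u y -> adj w y ->
     x != y -> adj x y).
Proof.
split=> [free u w x y uw ux wx uy wy xy|free [f f_inj fE]].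
  case xyE: (adj x y) => //; case: free.
  (* The missing edge of [diamond] joins vertices 0 and 1, so [x] and [y] come first. *)
  pose t := [:: x; y; u; w].
  have t_uniq : uniq t.
    by rewrite /= !inE !negb_or xy !(eq_sym x, eq_sym y) !neq_adj.
  exists (fun i : 'I_4 => nth x t i).
    by move=> i j /eqP; rewrite nth_uniq // => /eqP/val_inj.
  have := (xyE, uw, ux, wx, uy, wy).
  case=> [[[[[]]]]] h1 h2 h3 h4 h5 h6 i j.
  case: i j => [[|[|[|[|//]]]] ?] [[|[|[|[|//]]]] ?] /=;
    by rewrite ?adj_irrefl // ?h1 ?h2 ?h3 ?h4 ?h5 ?h6 // adj_sym
       ?h1 ?h2 ?h3 ?h4 ?h5 ?h6.
pose o (k : nat) (lt_k4 : k < 4) := f (Ordinal lt_k4).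
have := free (o 2 isT) (o 3 isT) (o 0 isT) (o 1 isT).
rewrite /o !fE (inj_eq f_inj) /=.
by move=> /(_ isT isT isT isT isT isT).
Qed.

Lemma induced_complement (H G : sgraph) :
  induced_subgraph H (complement G) -> induced_subgraph (complement H) G.
Proof.
move=> [f f_inj fE]; exists f => // x y.
rewrite /= /compl_adj -fE /= /compl_adj (inj_eq f_inj).
by case: eqVneq => [->|]; rewrite ?adj_irrefl //= negbK.
Qed.

Lemma induced_co_diamond_complement (G : sgraph) :
  induced_subgraph co_diamond (complement G) <-> induced_subgraph diamond G.
Proof.
split=> [/induced_complement [f f_inj fE]|[f f_inj fE]]; exists f => // x y.
  by rewrite fE /=; apply: adj_complement2.
by rewrite /= /compl_adj (inj_eq f_inj) fE.
Qed.

Lemma induced_diamond_complement (G : sgraph) :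
  induced_subgraph diamond (complement G) <-> induced_subgraph co_diamond G.
Proof.
split=> [/induced_complement //|[f f_inj fE]]; exists f => // x y.
rewrite /= /compl_adj (inj_eq f_inj) fE; apply: adj_complement2.
Qed.

Lemma free_complement (G : sgraph) :
  diamond_co_diamond_free G -> diamond_co_diamond_free (complement G).
Proof.
by case=> d c; split; [move/induced_diamond_complement|
  move/induced_co_diamond_complement].
Qed.

(** This is [diamond_freeP] in the complement with the two pairs exchanged: [u], [w] become the ends
    of the missing edge and [x], [y] the two vertices of degree 3. *)
Lemma co_diamond_freeP (G : sgraph) :
  ~ induced_subgraph co_diamond G <->
  (forall u w x y : G, adj u w -> ~~ adj u x -> ~~ adj w x -> ~~ adj u y ->
     ~~ adj w y -> x != y -> adj x y).
Proof.
split=> [free u w x y uw ux wx uy wy xy|free].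
  have {}free : ~ induced_subgraph diamond (complement G).
    by move/induced_diamond_complement.
  have cadj p q z : adj p q -> ~~ adj p z -> ~~ adj q z -> compl_adj z p.
    move=> pq pz qz; rewrite /compl_adj (adj_sym z) pz andbT.
    by apply: contraNneq qz => ->; rewrite adj_sym.
  have wu : adj w u by rewrite adj_sym.
  apply: contraT => nxy.
  suff /andP[_] : compl_adj u w by rewrite uw.
  apply: ((diamond_freeP (complement G)).1 free x y) (neq_adj uw);
    [by apply/andP | exact: cadj uw ux wx | exact: cadj uw uy wy |
     exact: cadj wu wx ux | exact: cadj wu wy uy].
move/induced_diamond_complement; apply/diamond_freeP => u w x y.
move=> /andP[uw nuw] /andP[ux nux] /andP[wx nwx] /andP[uy nuy] /andP[wy nwy] xy.
apply/andP; split=> //; apply: contra nuw => adjxy.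
by apply: (free x y) uw; rewrite // adj_sym.
Qed.

(** A boolean form, so that a maximum clique can be chosen and a non-clique yields a non-adjacent
    pair. *)
Definition cliqueb (G : sgraph) (S : {set G}) : bool :=
  [forall x in S, forall y in S, (x != y) ==> adj x y].

Lemma is_cliqueP (G : sgraph) (S : {set G}) :
  reflect (is_clique S) (cliqueb S).
Proof.
apply: (iffP 'forall_in_'forall_in_implyP) => [S_cl x y xS yS|S_cl x xS y yS].
  exact: S_cl.
exact: S_cl.
Qed.

Lemma clique_complement (G : sgraph) (S : {set G}) :
  is_clique (S : {set complement G}) <-> is_independent S.
Proof.
split=> S_cl x y xS yS; last by move=> xy; apply/andP; split=> //; apply: S_cl.
have [->|/S_cl] := eqVneq x y; first by rewrite adj_irrefl.
by case/(_ xS yS)/andP.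
Qed.

Lemma independent_complement (G : sgraph) (S : {set G}) :
  is_independent (S : {set complement G}) <-> is_clique S.
Proof.
split=> S_cl x y xS yS; first by move=> xy; have := S_cl x y xS yS;
  rewrite /= /compl_adj xy negbK.
by rewrite /= /compl_adj; case: eqVneq => //= /S_cl ->.
Qed.

Lemma has_clique_complement (G : sgraph) (k : nat) :
  has_clique (complement G) k <-> has_independent G k.
Proof. by split=> -[S] /clique_complement; exists S. Qed.

Lemma has_independent_complement (G : sgraph) (k : nat) :
  has_independent (complement G) k <-> has_clique G k.
Proof. by split=> -[S] /independent_complement; exists S. Qed.

(** * Shrinking, extending and listing cliques *)

Lemma sub_clique (G : sgraph) (S T : {set G}) :
  S \subset T -> is_clique T -> is_clique S.
Proof. by move=> /subsetP ST T_cl x y /ST xT /ST yT; apply: T_cl. Qed.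

Lemma has_clique_leq (G : sgraph) (S : {set G}) (k : nat) :
  is_clique S -> k <= #|S| -> has_clique G k.
Proof.
move=> S_cl /card_geqP[s [s_uniq s_size sS]].
exists [set x in s]; last by rewrite cardsE (card_uniqP s_uniq).
by apply: sub_clique S_cl; apply/subsetP => x; rewrite inE => /sS.
Qed.

Lemma has_independent_leq (G : sgraph) (S : {set G}) (k : nat) :
  is_independent S -> k <= #|S| -> has_independent G k.
Proof.
move=> /clique_complement S_cl leqkS; apply/has_clique_complement.
exact: has_clique_leq S_cl leqkS.
Qed.

Lemma cliqueU1 (G : sgraph) (v : G) (S : {set G}) :
  is_clique S -> {in S, forall x, adj v x} -> is_clique (v |: S).
Proof.
move=> S_cl vS x y /setU1P[->|xS] /setU1P[->|yS]; first by rewrite eqxx.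
- by move=> _; apply: vS.
- by move=> _; rewrite adj_sym; apply: vS.
- exact: S_cl.
Qed.

Lemma has_cliqueS (G : sgraph) (v : G) (S : {set G}) :
  is_clique S -> {in S, forall x, adj v x} -> has_clique G #|S|.+1.
Proof.
move=> S_cl vS; exists (v |: S); first exact: cliqueU1.
by rewrite cardsU1; case: (boolP (v \in S)) => // /vS; rewrite adj_irrefl.
Qed.

Lemma has_clique_pairwise (G : sgraph) (s : seq G) :
  pairwise (@adj G) s -> has_clique G (size s).
Proof.
move=> s_pw; exists [set y in s]; last first.
  rewrite cardsE; apply/card_uniqP; rewrite uniq_pairwise.
  by apply: sub_pairwise s_pw => y z /neq_adj.
elim: s s_pw => [_|x s IHs /= /andP[/allP xs /IHs s_cl]].
  by move=> y z; rewrite inE.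
by rewrite set_cons; apply: cliqueU1 => // y; rewrite inE => /xs.
Qed.

(** * Homogeneous sets of size 3 and 4 *)

Definition nbrs (G : sgraph) (v : G) : {set G} := [set x | adj v x].

Lemma card_nbrs (G : sgraph) (v : G) :
  #|nbrs v| + #|nbrs (v : complement G)| = #|G|.-1.
Proof.
have e : nbrs (v : complement G) = ~: nbrs v :\ v.
  by apply/setP=> x; rewrite !inE /= /compl_adj eq_sym.
have := cardsC (nbrs v); rewrite e (cardsD1 v (~: _)) !inE adj_irrefl /=.
lia.
Qed.

(** The classical bound: among 6 vertices, any vertex has degree at least 3 in [G] or in its
    complement. *)
Lemma has_clique3_or_independent3 (G : sgraph) :
  6 <= #|G| -> has_clique G 3 \/ has_independent G 3.
Proof.
have deg3 (H : sgraph) (v : H) :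
    3 <= #|nbrs v| -> has_clique H 3 \/ has_independent H 3.
  move=> deg_v.
  have [/existsP[x /existsP[y /and3P[]]]|noxy] :=
    boolP [exists x, exists y, [&& x \in nbrs v, y \in nbrs v & adj x y]].
    rewrite !inE => vx vy xy; left.
    by apply: (has_clique_pairwise (s := [:: v; x; y])); rewrite /= vx vy xy.
  right; apply: has_independent_leq deg_v => x y xv yv.
  by apply: contraNN noxy => xy; apply/existsP; exists x; apply/existsP; exists y;
    rewrite xv yv.
move=> card_G; have /card_gt0P[v _] : 0 < #|G| by lia.
have [/deg3//|lt3] := leqP 3 #|nbrs v|.
case: (deg3 (complement G) v); first by have := card_nbrs v; lia.
  by move/has_clique_complement; right.
by move/has_independent_complement; left.
Qed.

Lemma has_clique4_or_independent4_nbrs (G : sgraph) (v : G) :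
  diamond_co_diamond_free G -> 5 <= #|nbrs v| ->
  has_clique G 4 \/ has_independent G 4.
Proof.
move=> [/diamond_freeP dF /co_diamond_freeP cF] deg_v.
have [/existsP[x /existsP[y /and3P[]]]|noxy] :=
  boolP [exists x, exists y, [&& x \in nbrs v, y \in nbrs v & adj x y]];
  last first.
  right; apply: has_independent_leq (ltnW deg_v) => x y xv yv.
  by apply: contraNN noxy => xy; apply/existsP; exists x; apply/existsP; exists y;
    rewrite xv yv.
move=> xv yv xy; left.
set R := nbrs v :\ x :\ y.
have card_R : 3 <= #|R|.
  have := deg_v; rewrite (cardsD1 x) (cardsD1 y (_ :\ x)) -/R; lia.
have vR z : z \in R -> adj v z by rewrite !inE => /and3P[].
have [/is_cliqueP R_cl|] := boolP (cliqueb R).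
  by apply: has_clique_leq (cliqueU1 R_cl vR) _; rewrite cardsU1 !inE
    adj_irrefl !andbF.
rewrite !inE in xv yv.
case/forall_inPn => z zR /forall_inPn[t tR]; rewrite negb_imply => /andP[zt nzt].
(* In the triangle [v], [x], [y], a neighbour of [v] that sees one of [x], [y] must see both, or
   there is a diamond. *)
have xy_R w : w \in R -> adj x w || adj y w -> has_clique G 4.
  move=> wR; have vw := vR _ wR; move: wR; rewrite !inE => /and3P[wy wx _] xyw.
  have [xw yw] : adj x w /\ adj y w.
    case/orP: xyw => h; split=> //.
      by apply: (dF v x); rewrite // eq_sym.
    by apply: (dF v y); rewrite // 1?eq_sym // adj_sym.
  apply: (has_clique_pairwise (s := [:: v; x; y; w])).
  by rewrite /= xv yv vw xy xw yw.
have [xyz|] := boolP (adj x z || adj y z); first exact: xy_R xyz.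
rewrite negb_or => /andP[xz yz].
have [xyt|] := boolP (adj x t || adj y t); first exact: xy_R xyt.
rewrite negb_or => /andP[xt yt].
(* The edge [x y] and the non-adjacent pair [z], [t] would form a co-diamond. *)
by case/negP: nzt; apply: cF xy _ _ _ _ _.
Qed.

(** With 10 vertices the degrees of [v] in [G] and in the complement sum to at least 9, so one of
    them is at least 5. *)
Lemma has_clique4_or_independent4 (G : sgraph) :
  diamond_co_diamond_free G -> 10 <= #|G| ->
  has_clique G 4 \/ has_independent G 4.
Proof.
move=> G_free card_G; have /card_gt0P[v _] : 0 < #|G| by lia.
have [/(has_clique4_or_independent4_nbrs G_free)//|lt5] := leqP 5 #|nbrs v|.
case: (@has_clique4_or_independent4_nbrs (complement G) v (free_complement G_free)).
- by have := card_nbrs v; lia.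
- by move/has_clique_complement; right.
- by move/has_independent_complement; left.
Qed.

Lemma has_clique3_or_independent4 (G : sgraph) :
  diamond_co_diamond_free G -> 7 <= #|G| ->
  has_clique G 3 \/ has_independent G 4.
Proof.
move=> [_ /co_diamond_freeP cF] card_G.
case: (has_clique3_or_independent3 (ltnW card_G)) => [|[I I_ind card_I]].
  by left.
have [/existsP[x /andP[xI /forall_inP Ix]]|noX] :=
  boolP [exists x, (x \notin I) && [forall i in I, ~~ adj x i]].
  right; apply: (has_independent_leq (S := x |: I)); last first.
    by rewrite cardsU1 xI card_I.
  move=> i j /setU1P[->|iI] /setU1P[->|jI]; rewrite ?adj_irrefl //.
  - exact: Ix.
  - by rewrite adj_sym Ix.
  - exact: I_ind.
have two_nbrs x : x \notin I -> 2 <= #|I :&: nbrs x|.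
  move=> xI; have [j jI xj] : exists2 j, j \in I & adj x j.
    move: noX; rewrite negb_exists => /forallP/(_ x).
    rewrite xI /= => /forall_inPn[j jI]; rewrite negbK => xj; by exists j.
  (* Two non-neighbours of [x] in [I], with the edge [x j], would form a co-diamond. *)
  suff : #|I :\: nbrs x| <= 1 by have := cardsID (nbrs x) I; rewrite card_I; lia.
  rewrite leqNgt; apply/card_gt1P => -[i1 [i2 []]]; rewrite !inE.
  move=> /andP[xi1 i1I] /andP[xi2 i2I] i12.
  by case/negP: (I_ind _ _ i1I i2I); apply: (cF x j) => //; exact: I_ind.
have [/existsP[x /existsP[y /and3P[xI yI xy]]]|noxy] :=
  boolP [exists x, exists y, [&& x \notin I, y \notin I & adj x y]].
  (* Two subsets of size at least 2 in the three-element set [I] must meet. *)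
  left; have [i] : exists i, i \in (I :&: nbrs x) :&: (I :&: nbrs y).
    apply/card_gt0P; have := cardsUI (I :&: nbrs x) (I :&: nbrs y).
    have : #|(I :&: nbrs x) :|: (I :&: nbrs y)| <= #|I|.
      by apply: subset_leq_card; rewrite -setIUr subsetIl.
    have := two_nbrs _ xI; have := two_nbrs _ yI; rewrite card_I; lia.
  rewrite !inE => /andP[/andP[_ xi] /andP[_ yi]].
  by apply: (has_clique_pairwise (s := [:: x; y; i])); rewrite /= xy xi yi.
right; apply: (has_independent_leq (S := ~: I)).
  move=> x y; rewrite !inE => xI yI.
  by apply: contraNN noxy => xy; apply/existsP; exists x; apply/existsP; exists y;
    rewrite xI yI.
have := cardsC I; rewrite card_I; lia.
Qed.

(** * Covering by two homogeneous sets *)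

Lemma large_clique (G : sgraph) :
  diamond_co_diamond_free G -> has_clique G 4 ->
  exists2 T : {set G}, is_clique T & #|G| <= 2 * #|T|.
Proof.
move=> [/diamond_freeP dF /co_diamond_freeP cF] [S /is_cliqueP S_cl card_S].
case: (arg_maxnP (fun T : {set G} => #|T|) S_cl) => T /is_cliqueP T_cl T_max.
have {}card_S : 4 <= #|T| by rewrite -card_S; apply: T_max.
exists T => //.
(* Given two neighbours of [x] in [T], diamond-freeness joins [x] to all of [T], against
   maximality. *)
have one_nbr x : x \notin T -> #|T :&: nbrs x| <= 1.
  move=> xT; rewrite leqNgt; apply/card_gt1P => -[t1 [t2 []]]; rewrite !inE.
  move=> /andP[t1T xt1] /andP[t2T xt2] t12.
  suff xT_cl : is_clique (x |: T).
    by have /is_cliqueP/T_max := xT_cl; rewrite cardsU1 xT add1n /= ltnn.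
  apply: cliqueU1 => // t tT.
  have [<-//|tt1] := eqVneq t1 t; have [<-//|tt2] := eqVneq t2 t.
  rewrite adj_sym in xt1; rewrite adj_sym in xt2.
  apply: (dF t1 t2) => //; [exact: T_cl | exact: T_cl | exact: T_cl |].
  by apply: contraNneq xT => ->.
suff T'_cl : is_clique (~: T).
  have /is_cliqueP/T_max := T'_cl; have := cardsC T; lia.
move=> x y; rewrite !inE => xT yT xy.
(* Each of [x], [y] sees at most one of the at least four vertices of [T], so two are left, and they
   span an edge missed by both. *)
have /card_gt1P[u [w []]] : 1 < #|T :\: (nbrs x :|: nbrs y)|.
  have := cardsID (nbrs x :|: nbrs y) T; rewrite setIUr.
  have := cardsU (T :&: nbrs x) (T :&: nbrs y).
  have := one_nbr _ xT; have := one_nbr _ yT; lia.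
rewrite !inE !negb_or => /andP[/andP[xu yu] uT] /andP[/andP[xw yw] wT] uw.
by apply: (cF u w); rewrite 1?adj_sym // T_cl // eq_sym.
Qed.

Lemma large_independent (G : sgraph) :
  diamond_co_diamond_free G -> has_independent G 4 ->
  exists2 T : {set G}, is_independent T & #|G| <= 2 * #|T|.
Proof.
move=> /free_complement G_free /has_clique_complement.
by move=> /(large_clique G_free)[T /clique_complement]; exists T.
Qed.

(** * Upper bound *)

(** Outside [a = b = 3] the threshold is at least [2 * a - 1] and [2 * b - 1]. Since
    [2 * a - 1 <= 2 * #|T|] forces [a <= #|T|], a clique of size 4 grows to size [a], and dually for
    [b]. *)
Lemma ramsey_upper_bound (a b : nat) (ha : 3 <= a) (hb : 3 <= b) :
  ramsey_bound diamond_co_diamond_free a b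
    (if (a == 3) && (b == 3) then 6
     else if (a \in [:: 4; 5]) && (b \in [:: 4; 5]) then 10
     else maxn (2 * a - 1) (2 * b - 1)).
Proof.
move nE: (X in ramsey_bound _ _ _ X) => n G G_free card_G.
have clique_a : 2 * a - 1 <= n -> has_clique G 4 -> has_clique G a.
  move=> an /(large_clique G_free)[T T_cl card_T].
  by apply: has_clique_leq T_cl _; lia.
have independent_b : 2 * b - 1 <= n -> has_independent G 4 -> has_independent G b.
  move=> bn /(large_independent G_free)[T T_ind card_T].
  by apply: has_independent_leq T_ind _; lia.
rewrite !inE in nE.
have [a3|a_gt3] := eqVneq a 3.
  have [b3|b_gt3] := eqVneq b 3.
    rewrite a3 b3; apply: has_clique3_or_independent3.
    by move: nE card_G; rewrite a3 b3 /= => <-.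
  rewrite a3 (negPf b_gt3) /= in nE.
  (* Here [b] is at least 4, whence 7. *)
  have bn : 7 <= n /\ 2 * b - 1 <= n by lia.
  case: (has_clique3_or_independent4 G_free); first lia.
    by rewrite a3; left.
  by right; apply: independent_b => //; lia.
have [b3|b_gt3] := eqVneq b 3.
  rewrite b3 (negPf a_gt3) !andbF /= in nE.
  have an : 7 <= n /\ 2 * a - 1 <= n by lia.
  case: (has_clique3_or_independent4 (free_complement G_free));
    first by apply: leq_trans card_G; case: an.
    by move/has_clique_complement; rewrite b3; right.
  by move/has_independent_complement=> ?; left; apply: clique_a => //; lia.
(* If [a] and [b] are not both in {4, 5}, one of them is at least 6 and the maximum is at least
   11. *)
have [n10 an bn] : [/\ 10 <= n, 2 * a - 1 <= n & 2 * b - 1 <= n].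
  by move: nE; rewrite (negPf a_gt3) /=; case: ifP; split; lia.
case: (has_clique4_or_independent4 G_free); first lia.
  by left; apply: clique_a.
by right; apply: independent_b.
Qed.

(** * Lower bounds from extremal graphs and colourings *)

Lemma ramsey_bound_gt (G : sgraph) (a b m : nat) :
  diamond_co_diamond_free G ->
  (forall S : {set G}, is_clique S -> #|S| < a) ->
  (forall S : {set G}, is_independent S -> #|S| < b) ->
  ramsey_bound diamond_co_diamond_free a b m -> #|G| < m.
Proof.
move=> G_free lt_clique lt_indep bound; rewrite ltnNge.
apply/negP => /(bound G G_free)[] [S].
  by move/lt_clique=> lt_S eq_S; rewrite eq_S ltnn in lt_S.
by move/lt_indep=> lt_S eq_S; rewrite eq_S ltnn in lt_S.
Qed.

Lemma leq_clique_colouring (G : sgraph) (C : finType) (c : G -> C) (S : {set G}) :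
  (forall x y, adj x y -> c x != c y) -> is_clique S -> #|S| <= #|C|.
Proof.
move=> c_proper S_cl; have <- : #|c @: S| = #|S|; last exact: max_card.
apply: card_in_imset => x y xS yS cxy.
by apply/eqP/negP => /negP /(S_cl _ _ xS yS) /c_proper; rewrite cxy eqxx.
Qed.

(** The colour classes are cliques, so [c] is a proper colouring of the complement. *)
Lemma leq_independent_colouring (G : sgraph) (C : finType) (c : G -> C)
    (S : {set G}) :
  (forall x y, x != y -> ~~ adj x y -> c x != c y) -> is_independent S ->
  #|S| <= #|C|.
Proof.
move=> c_proper /clique_complement.
by apply: (leq_clique_colouring (c := c : complement G -> C)) => x y /andP[];
  apply: c_proper.
Qed.

(** * Disjoint union of two equal cliques *)

Definition two_cliques_adj (k : nat) : rel (bool * 'I_k) :=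
  fun x y => (x != y) && (x.1 == y.1).

Lemma two_cliques_adj_sym (k : nat) : symmetric (@two_cliques_adj k).
Proof. by move=> x y; rewrite /two_cliques_adj eq_sym (eq_sym x.1). Qed.

Lemma two_cliques_adj_irrefl (k : nat) : irreflexive (@two_cliques_adj k).
Proof. by move=> x; rewrite /two_cliques_adj eqxx. Qed.

Definition two_cliques (k : nat) : sgraph :=
  SGraph (@two_cliques_adj_sym k) (@two_cliques_adj_irrefl k).

Lemma two_cliques_free (k : nat) : diamond_co_diamond_free (two_cliques k).
Proof.
split; [apply/diamond_freeP | apply/co_diamond_freeP];
  move=> u w x y /=; rewrite /two_cliques_adj.
  by move=> _ /andP[_ /eqP ux] _ /andP[_ /eqP uy] _ ->; rewrite -ux uy /=.
move=> /andP[uw /eqP uw1] ux wx uy wy ->.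
(* A vertex adjacent to neither end of an edge lies in the other clique; this applies to both [x]
   and [y]. *)
have far z : ~~ ((u != z) && (u.1 == z.1)) -> ~~ ((w != z) && (w.1 == z.1)) ->
    z.1 = ~~ u.1.
  have [<- _|_ /=] := eqVneq u z; first by rewrite eq_sym uw uw1 eqxx.
  by move=> uz _; case: u.1 z.1 uz => [] [].
by rewrite (far x) // (far y) //= eqxx.
Qed.

Lemma card_two_cliques (k : nat) : #|two_cliques k| = 2 * k.
Proof. by rewrite card_prod card_bool card_ord. Qed.

Lemma two_cliques_clique (k : nat) (S : {set two_cliques k}) :
  is_clique S -> #|S| <= k.
Proof.
rewrite -[leqRHS]card_ord.
apply: (leq_clique_colouring (c := snd : two_cliques k -> 'I_k)) => x y.
by case: x y => [x1 x2] [y1 y2] /andP[]; rewrite xpair_eqE /=; case: eqP.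
Qed.

Lemma two_cliques_independent (k : nat) (S : {set two_cliques k}) :
  is_independent S -> #|S| <= 2.
Proof.
rewrite -[leqRHS]card_bool.
apply: (leq_independent_colouring (c := fst : two_cliques k -> bool)) => x y.
by move=> xy; rewrite /= /two_cliques_adj xy.
Qed.

(** * The 5-cycle *)

Definition cycle5_adj : rel 'I_5 :=
  fun x y => (y == x.+1 %% 5 :> nat) || (x == y.+1 %% 5 :> nat).

Lemma cycle5_adj_sym : symmetric cycle5_adj.
Proof. by move=> x y; rewrite /cycle5_adj orbC. Qed.

Lemma cycle5_adj_irrefl : irreflexive cycle5_adj.
Proof. by case=> [[|[|[|[|[|//]]]]] ?]. Qed.

Definition cycle5 : sgraph := SGraph cycle5_adj_sym cycle5_adj_irrefl.

Lemma cycle5_triangle_free (x y z : cycle5) : adj x y -> adj x z -> ~~ adj y z.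
Proof.
by case: x y z => [[|[|[|[|[|//]]]]] ?] [[|[|[|[|[|//]]]]] ?]
  [[|[|[|[|[|//]]]]] ?].
Qed.

Lemma cycle5_independent_free (x y z : cycle5) :
  x != y -> x != z -> y != z -> ~~ adj x y -> ~~ adj x z -> adj y z.
Proof.
by case: x y z => [[|[|[|[|[|//]]]]] ?] [[|[|[|[|[|//]]]]] ?]
  [[|[|[|[|[|//]]]]] ?].
Qed.

(** A diamond contains a triangle, and a co-diamond contains three independent vertices, here [u],
    [x], [y]. *)
Lemma cycle5_free : diamond_co_diamond_free cycle5.
Proof.
split; [apply/diamond_freeP | apply/co_diamond_freeP] => u w x y.
  by move=> uw ux wx; have := cycle5_triangle_free uw ux; rewrite wx.
move=> uw ux wx uy wy xy; apply: (@cycle5_independent_free u) => //.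
  by apply: contraNneq wx => <-; rewrite adj_sym.
by apply: contraNneq wy => <-; rewrite adj_sym.
Qed.

Lemma cycle5_clique (S : {set cycle5}) : is_clique S -> #|S| < 3.
Proof.
move=> S_cl; rewrite ltnNge; apply/card_gt2P => -[x [y [z []]]].
move=> [xS yS zS] [xy yz zx].
have xyA := S_cl x y xS yS xy; have yzA := S_cl y z yS zS yz.
have zxA := S_cl z x zS xS zx.
have xzA : adj x z by rewrite adj_sym.
by have := cycle5_triangle_free xyA xzA; rewrite yzA.
Qed.

Lemma cycle5_independent (S : {set cycle5}) : is_independent S -> #|S| < 3.
Proof.
move=> S_ind; rewrite ltnNge; apply/card_gt2P => -[x [y [z []]]].
move=> [xS yS zS] [xy yz zx]; rewrite eq_sym in zx.
case/negP: (S_ind y z yS zS); apply: (@cycle5_independent_free x) => //.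
all: exact: S_ind.
Qed.

(** * The 3 x 3 rook's graph *)

Definition rook3_adj : rel ('I_3 * 'I_3) :=
  fun x y => (x != y) && ((x.1 == y.1) || (x.2 == y.2)).

Lemma rook3_adj_sym : symmetric rook3_adj.
Proof.
by move=> x y; rewrite /rook3_adj eq_sym (eq_sym x.1) (eq_sym x.2).
Qed.

Lemma rook3_adj_irrefl : irreflexive rook3_adj.
Proof. by move=> x; rewrite /rook3_adj eqxx. Qed.

Definition rook3 : sgraph := SGraph rook3_adj_sym rook3_adj_irrefl.

Lemma third_ord3 (i j k l : 'I_3) :
  i != j -> i != k -> j != k -> i != l -> j != l -> k = l.
Proof.
by case: i j k l => [[|[|[|//]]] ?] [[|[|[|//]]] ?] [[|[|[|//]]] ?]
  [[|[|[|//]]] ?] //= _ _ _ _ _; apply/val_inj.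
Qed.

(** For cells [(a, c)] and [(a, d)] of one row: a cell [(p, q)] outside that row cannot share its
    column with both. *)
Lemma rook3_common_nbr (a c d p q : 'I_3) :
  c != d -> (a == p) || (c == q) -> (a == p) || (d == q) -> a = p.
Proof.
have [//|_ /= ncd /eqP cq /eqP dq] := eqVneq a p.
by rewrite cq dq eqxx in ncd.
Qed.

(** The hypotheses are non-adjacency in unfolded form. A cell of row [a] adjacent to neither
    [(a, c)] nor [(a, d)] would have to equal both. *)
Lemma rook3_common_non_nbr (a c d p q : 'I_3) :
  c != d -> ~~ (~~ ((a == p) && (c == q)) && ((a == p) || (c == q))) ->
  ~~ (~~ ((a == p) && (d == q)) && ((a == p) || (d == q))) ->
  c != q /\ d != q.
Proof.
case: (a == p) => //= ncd; rewrite !andbT !negbK => /eqP cq /eqP dq.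
by rewrite cq dq eqxx in ncd.
Qed.

(** Take an edge inside a row. Its common neighbours lie in that row, and its common non-neighbours
    in the third column, so either kind is pairwise adjacent. Edges inside a column follow by
    swapping coordinates. *)
Lemma rook3_free : diamond_co_diamond_free rook3.
Proof.
split; [apply/diamond_freeP | apply/co_diamond_freeP];
  case=> [u1 u2] [w1 w2] [x1 x2] [y1 y2] /=; rewrite /rook3_adj /= !xpair_eqE.
  move=> /andP[n /orP[] /eqP e]; rewrite e eqxx ?andbT /= in n *;
    move=> /andP[_ ux] /andP[_ wx] /andP[_ uy] /andP[_ wy] ->.
    by rewrite -(rook3_common_nbr n ux wx) -(rook3_common_nbr n uy wy) eqxx.
  rewrite orbC in ux; rewrite orbC in wx; rewrite orbC in uy; rewrite orbC in wy.
  by rewrite -(rook3_common_nbr n ux wx) -(rook3_common_nbr n uy wy) eqxx orbT.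
move=> /andP[n /orP[] /eqP e]; rewrite e eqxx ?andbT /= in n *;
  last rewrite ![(_ == _) && (w2 == _)]andbC ![(_ == _) || (w2 == _)]orbC;
  move=> ux wx uy wy ->.
all: have [ux' wx'] := rook3_common_non_nbr n ux wx.
all: have [uy' wy'] := rook3_common_non_nbr n uy wy.
all: by rewrite (third_ord3 n ux' wx' uy' wy') eqxx ?orbT.
Qed.

Lemma card_rook3 : #|rook3| = 9.
Proof. by rewrite card_prod card_ord. Qed.

(* The diagonals [x.1 + x.2 = const] mod 3 give a proper 3-colouring. *)
Lemma rook3_clique (S : {set rook3}) : is_clique S -> #|S| <= 3.
Proof.
rewrite -[leqRHS]card_ord.
apply: (leq_clique_colouring 
  (c := (fun x => inord ((x.1 + x.2) %% 3)) : rook3 -> 'I_3)).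
case=> [x1 x2] [y1 y2] /=; rewrite /rook3_adj xpair_eqE /= => xy.
rewrite -val_eqE /= !inordK ?ltn_mod //; move: xy.
by case: x1 x2 y1 y2 => [[|[|[|//]]] ?] [[|[|[|//]]] ?] [[|[|[|//]]] ?]
  [[|[|[|//]]] ?].
Qed.

(** The three rows are cliques that cover the graph. *)
Lemma rook3_independent (S : {set rook3}) : is_independent S -> #|S| <= 3.
Proof.
rewrite -[leqRHS]card_ord.
apply: (leq_independent_colouring (c := fst : rook3 -> 'I_3)) => x y xy.
by rewrite /= /rook3_adj xy negb_or => /andP[].
Qed.

(** * Lower bound and conclusion *)

Lemma ramsey_lower_bound (a b m : nat) (ha : 3 <= a) (hb : 3 <= b) :
  ramsey_bound diamond_co_diamond_free a b m ->
  (if (a == 3) && (b == 3) then 6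
   else if (a \in [:: 4; 5]) && (b \in [:: 4; 5]) then 10
   else maxn (2 * a - 1) (2 * b - 1)) <= m.
Proof.
move=> bound; case: ifP => [/andP[/eqP a3 /eqP b3]|_].
  (* [6 <= m] is [5 < m] by definition, with 5 the order of [cycle5]. *)
  rewrite -[X in X < _](card_ord 5).
  apply: (ramsey_bound_gt cycle5_free) bound => S.
    by rewrite a3; apply: cycle5_clique.
  by rewrite b3; apply: cycle5_independent.
case: ifP => [|_].
  rewrite !inE => ab; rewrite -card_rook3.
  apply: (ramsey_bound_gt rook3_free) bound => S.
    by move/rook3_clique; lia.
  by move/rook3_independent; lia.
(* Two cliques of size [a - 1] have independent sets of size at most 2, below [b]; the complement of
   two cliques of size [b - 1] plays the dual part. *)
have ma : 2 * a.-1 < m.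
  rewrite -card_two_cliques.
  apply: (ramsey_bound_gt (two_cliques_free a.-1)) bound => S.
    by move/two_cliques_clique; lia.
  by move/two_cliques_independent; lia.
have mb : 2 * b.-1 < m.
  rewrite -card_two_cliques.
  have G_free := free_complement (two_cliques_free b.-1).
  apply: (ramsey_bound_gt G_free) bound => S.
    by move/clique_complement/two_cliques_independent => /leq_ltn_trans; apply.
  move/independent_complement/two_cliques_clique => /leq_ltn_trans; apply.
  lia.
lia.
Qed.

Theorem theorem4 (a b : nat) (ha : 3 <= a) (hb : 3 <= b) :
  is_ramsey_number diamond_co_diamond_free a b
    (if (a == 3) && (b == 3) then 6
     else if (a \in [:: 4; 5]) && (b \in [:: 4; 5]) then 10
     else maxn (2 * a - 1) (2 * b - 1)).
Proof.
split; first exact: ramsey_upper_bound.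
by move=> m; apply: ramsey_lower_bound.
Qed.
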